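(* Let $F=(f_m)_{m\in\mathbb{N}_0}\subset L^2(\mathbb{R}^d)$ be a sequence and let $\delta>0$. Suppose that for all tolerances $(\eta_k)_{k\in\mathbb{N}_0}\in\mathbb{R}_{>0}^{\mathbb{N}_0}$ there exist finite sets $\Psi_k\subseteq\Psi$, $k\in\mathbb{N}_0$, and a subsequence $(f_{m_k})_{k\in\mathbb{N}_0}$ of $F$ with $m_0=0$ such that the following hold: (i) $C_F:=\sup_{m\in\mathbb{N}_0}\|f_m\|_2^2$ is finite, i.e., $F$ is a bounded sequence. (ii) For all $j,k\in\mathbb{N}_0$ with $j<k$: $|\langle f_{m_k},f_{m_j}\rangle|\le\eta_k$. (iii) $\Psi_{k_1}\cap\Psi_{k_2}=\emptyset$ whenever $k_1\ne k_2$. (iv) For every $k\in\mathbb{N}_0$: $\sum_{\psi\in\Psi\setminus\Psi_k}\|f_{m_k}*\psi\|_2^2\le\eta_k$. (v) For every $k\in\mathbb{N}_0$ and $0\le j<k$: $\sum_{\psi\in\Psi_k}\|f_{m_j}*\psi\|_2^2\le\eta_k$. (vi) For all $k\in\mathbb{N}$: $W_k(f_{m_k})\ge 4\delta$. If $E=(E_N)_{N\in\mathbb{N}}\in\mathbb{R}_{>0}^{\mathbb{N}}$ is a nonincreasing null-sequence, then there exists $f_E\in L^2(\mathbb{R}^d)$ that satisfies a) $\|f_E\|_2^2\le 2C_F\cdot(1+E_1)$, b) $\|f_E-f_0\|_2^2\le 2C_F\cdot E_1$, and c) for all $N\in\mathbb{N}$, $W_N(f_E)\ge\delta\cdot E_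N$.
   Context: Fix $d\in\mathbb{N}=\{1,2,\dots\}$, $\mathbb{N}_0=\mathbb{N}\cup\{0\}$. $L^2(\mathbb{R}^d)$ is the space of complex-valued square-integrable functions. Standing assumption on the filters: $\chi\in L^1(\mathbb{R}^d)\cap L^2(\mathbb{R}^d)$ and $\Psi\subset L^1(\mathbb{R}^d)\cap L^2(\mathbb{R}^d)$ are such that $\mathfrak{F}=\{\chi\}\cup\Psi$ is countably infinite and is a semi-discrete Parseval frame, i.e. $\|f*\chi\|_2^2+\sum_{\psi\in\Psi}\|f*\psi\|_2^2=\|f\|_2^2$ for all $f\in L^2(\mathbb{R}^d)$. For a path $p=(\psi_1,\dots,\psi_N)$ of functions in $L^1(\mathbb{R}^d)\cap L^2(\mathbb{R}^d)$ set $U[p]f:=|\dots||f*\psi_1|*\psi_2|\dots*\psi_N|$ (convolve, take the pointwise modulus, and iterate), and $U[e]f:=f$ for the empty path $e$. The energy remainder is $W_N(f):=W_N[\Psi](f):=\sum_{p\in\Psi^N}\|U[p]f\|_2^2$ (with $\Psi^0=\{e\}$). A null-sequence is a sequence converging to $0$. A subsequence $(f_{m_k})_k$ is given by strictly increasing indices $m_k$. *)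

(* Defs.v *)
From HB Require Import structures.
From mathcomp Require Import all_boot all_order all_algebra.
From mathcomp Require Import all_classical all_reals all_analysis.
From mathcomp Require Export complex.

Set Implicit Arguments.
Unset Strict Implicit.
Unset Printing Implicit Defensive.

Import Order.TTheory GRing.Theory Num.Theory.
Import numFieldNormedType.Exports.

Local Open Scope classical_set_scope.
Local Open Scope ring_scope.

(* R^d is d.-tuple R with the product sigma-algebra of the Borel sigma-algebra
   of R, that is, the Borel sigma-algebra of R^d. *)
Section lebesgue_on_tuples.
Context (R : realType).

Definition cons_pair n (x : R * n.-tuple R) : n.+1.-tuple R :=
  [tuple of x.1 :: x.2].

Lemma measurable_cons_pair n : measurable_fun [set: R * n.-tuple R]
  (@cons_pair n).
Proof. by apply: measurable_cons; [exact: measurable_fst|exact: measurable_snd]. Qed.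

Section step.
Variables (n : nat) (mu : {sigma_finite_measure set (n.-tuple R) -> \bar R}).

Definition lebesgue_step : set (n.+1.-tuple R) -> \bar R :=
  pushforward (lebesgue_measure \x mu)%E (@cons_pair n).

Let lebesgue_step0 : lebesgue_step set0 = 0%E.
Proof. by rewrite /lebesgue_step /pushforward preimage_set0 measure0. Qed.

Let lebesgue_step_ge0 A : (0 <= lebesgue_step A)%E.
Proof. by rewrite /lebesgue_step /pushforward; exact: measure_ge0. Qed.

Let lebesgue_step_sigma_additive : semi_sigma_additive lebesgue_step.
Proof.
move=> F mF tF mUF; rewrite /lebesgue_step /pushforward preimage_bigcup.
apply: measure_semi_sigma_additive.
- by move=> k; rewrite -[X in measurable X]setTI; exact: measurable_cons_pair.
- apply/trivIsetP => /= i j _ _ ij; rewrite -preimage_setI.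
  by move/trivIsetP : tF => /(_ _ _ _ _ ij) ->//; rewrite preimage_set0.
- by rewrite -preimage_bigcup -[X in measurable X]setTI;
    exact: measurable_cons_pair.
Qed.

HB.instance Definition _ := isMeasure.Build _ _ _ lebesgue_step
  lebesgue_step0 lebesgue_step_ge0 lebesgue_step_sigma_additive.

Let lebesgue_step_sigma_finite : sigma_finite setT lebesgue_step.
Proof.
have /sigma_finiteP[F [TF ndF Foo]] :=
  sigma_finiteT (@lebesgue_measure R : {sigma_finite_measure set _ -> \bar R}).
have /sigma_finiteP[G [TG ndG Goo]] := sigma_finiteT mu.
pose uncons (t : n.+1.-tuple R) : measurableTypeR R * n.-tuple R :=
  (thead t, [tuple of behead t]).
have muncons : measurable_fun setT uncons.
  by apply: measurable_fun_pair; [exact: measurable_tnth|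
    exact: measurable_behead].
have consK x : uncons (cons_pair x) = x.
  by case: x => x t; congr pair; apply/val_inj.
exists (fun k => uncons @^-1` (F k `*` G k)).
  apply/esym; rewrite -subTset => t _.
  have [i _ Fi] : (\bigcup_i F i) (thead t) by rewrite -TF.
  have [j _ Gj] : (\bigcup_j G j) [tuple of behead t] by rewrite -TG.
  exists (maxn i j) => //; split => /=.
    by move: Fi; exact/subsetPset/ndF/leq_maxl.
  by move: Gj; exact/subsetPset/ndG/leq_maxr.
move=> k; have [mF Fkoo] := Foo k; have [mG Gkoo] := Goo k; split.
  by rewrite -[X in measurable X]setTI; apply: muncons => //;
    exact: measurableX.
rewrite /lebesgue_step /pushforward.
rewrite (_ : _ @^-1` _ = F k `*` G k); last first.
  by apply/funext => x; exact: (congr1 (F k `*` G k) (consK x)).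
by rewrite product_measure1E// lte_mul_pinfty// ge0_fin_numE.
Qed.

HB.instance Definition _ := Measure_isSigmaFinite.Build _ _ _ lebesgue_step
  lebesgue_step_sigma_finite.

End step.

Fixpoint lebesgue_tuple n : {sigma_finite_measure set (n.-tuple R) -> \bar R} :=
  if n is m.+1 then lebesgue_step (lebesgue_tuple m) else \d_[tuple].

End lebesgue_on_tuples.

(* Elements of the spaces L^p are represented by Borel functions; almost
   everywhere equality is dealt with by [ae_distinct] below. *)
Notation cfun R d := (d.-tuple R -> R[i]).

Section scattering.
Context {R : realType} {d : nat}.
Implicit Types (f g psi : cfun R d) (Psi : set (cfun R d)).

Local Notation mu := (lebesgue_tuple R d).
Local Notation normc := (@ComplexField.Normc.normc R).

Definition cmeasurable f : Prop :=
  measurable_fun setT (fun x => complex.Re (f x)) /\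
  measurable_fun setT (fun x => complex.Im (f x)).

Definition cLnorm (p : \bar R) f : \bar R :=
  Lnorm mu p (fun x => (normc (f x))%:E).

Definition cLfun (p : \bar R) : set (cfun R d) :=
  [set f | cmeasurable f /\ (cLnorm p f < +oo)%E].

Definition L2normsq f : \bar R := (cLnorm 2%:E f ^+ 2)%E.

Definition sup_L2normsq (F : nat -> cfun R d) : \bar R :=
  ereal_sup (range (fun m => L2normsq (F m))).

Definition cintegral f : R[i] :=
  Complex (\int[mu]_x complex.Re (f x)) (\int[mu]_x complex.Im (f x)).

Definition inner_product f g : R[i] := cintegral (fun x => f x * conjc (g x)).

Definition tuple_sub (x y : d.-tuple R) : d.-tuple R :=
  [tuple tnth x i - tnth y i | i < d].

Definition convolution f g : cfun R d :=
  fun x => cintegral (fun y => f y * g (tuple_sub x y)).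

Definition modulus f : cfun R d := fun x => `|f x|.

Definition path_propagator (p : seq (cfun R d)) f : cfun R d :=
  foldl (fun g psi => modulus (convolution g psi)) f p.

Definition energy_remainder Psi (N : nat) f : \bar R :=
  (\esum_(p in [set p : N.-tuple (cfun R d) | forall i, Psi (tnth p i)])
     L2normsq (path_propagator p f))%E.

(* Distinct functions of A are distinct elements of L^p, so that A is a set of
   representatives, one for each member of a subset of L^p; sums, disjointness
   and cardinality over A are then those over the subset. *)
Definition ae_distinct (A : set (cfun R d)) : Prop :=
  forall f g, A f -> A g -> f = g %[ae mu] -> f = g.

Definition semi_discrete_Parseval_frame (chi : cfun R d) Psi : Prop :=
  forall f, cLfun 2%:E f ->
    (L2normsq (convolution f chi) + \esum_(psi in Psi) L2normsq (convolution f psi)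
      = L2normsq f)%E.

End scattering.

(* Main.v *)
Require Import Defs.
From HB Require Import structures.
From mathcomp Require Import all_boot all_order all_algebra.
From mathcomp Require Import all_classical all_reals all_analysis.
From mathcomp Require Import complex measurable_realfun ring lra.

(** Write g_l for the term of the sequence with index m_(k_l), where k_l is so
large that E stays below 64^-(l+1) E_1 from k_l on.  The function sought is
f_0 + h with h = sum_l c_l g_l, c_l = r 8^-l and r^2 = (3/4) E_1.

A given depth N is served by a single summand.  For the least l with
N <= k_l one has E_N <= 64^-l E_1 = (4/3) c_l^2 [exists_scale], and
W_N(g_l) >= W_(k_l)(g_l) >= 4 delta, since the energy remainder decreases with
the depth [energy_remainder_antitone].  So it is enough that f_0 + h inherits
about half of W_N(c_l g_l) >= 4 delta c_l^2.

The transfer rests on the quadratic continuity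
W_N(u) <= 2 W_N(v) + 2 |u - v|^2 [energy_remainder_near]: convolving with all
filters does not increase the total energy, by the Parseval identity, and the
modulus is nonexpansive.  Applied only from the second layer on, and only along
the filters of Phi = Psi_(k_l) [energy_remainder_layer], it leaves as error the
energy of c_l g_l outside Phi and the energy that Phi sees of
f_0 + sum_(j <> l) c_j g_j.  Both are at most a small multiple of c_l^2: Phi
hardly sees the earlier terms, and it hardly sees a later g_j because it is
disjoint from the set Psi_(k_j) that carries g_j; with tolerances eps 64^-k the
energy of every g_j with j <> l within Phi is at most eps 64^-l.  The seen
energy is a quadratic functional, hence sums of it are controlled termwise up to
a factor 2 for each addition [layer_energy_partial_sum], and what remains of the
series after finitely many terms is small in norm
[energy_remainder_superposition].

The constants balance two demands.  The weighted Cauchy-Schwarz inequality gives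
|h|^2 <= (sum_l c_l)^2 C_F = (8/7 r)^2 C_F = (48/49) E_1 C_F [L2_series], which
yields both norm bounds, while half of 4 delta c_l^2 is still
(3/2) delta 64^-l E_1 >= (3/2) delta E_N, so that a third of it may be lost.

All of this uses that convolution is linear at every point.  Its integrand is
dominated by |f(y)|^2 + |psi(x - y)|^2, which is integrable because Lebesgue
measure is invariant under y |-> x - y [ge0_integral_tuple_sub]. *)

Set Implicit Arguments.
Unset Strict Implicit.
Unset Printing Implicit Defensive.

Import Order.TTheory GRing.Theory Num.Theory.
Import numFieldNormedType.Exports.

Local Open Scope classical_set_scope.
Local Open Scope ring_scope.

(** * Invariance of Lebesgue measure under y |-> x - y *)

Section reflection_invariance.
Context {R : realType}.
Local Notation lambda := (@lebesgue_measure R).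

Lemma measurable_sub_cst (a : R) :
  measurable_fun setT (fun t : measurableTypeR R => a - t : measurableTypeR R).
Proof. exact: measurable_funB. Qed.

(** Lebesgue measure is determined by its values on half-open intervals, and the
preimage of such an interval is an interval of the same length. *)
Lemma lebesgue_measure_subl (a : R) (A : set R) : measurable A ->
  pushforward lambda (fun t : measurableTypeR R => a - t : measurableTypeR R) A
  = lambda A.
Proof.
move=> mA; apply/esym.
have mf := measurable_sub_cst a.
pose phi : {mfun _ >-> _} := HB.pack (fun t : measurableTypeR R => a - t : measurableTypeR R)
  (isMeasurableFun.Build _ _ _ _ _ mf).
apply: (@lebesgue_measure_unique R (pushforward lambda phi)) => //= _ [[b c]] _ <-.
rewrite /pushforward.
rewrite (_ : (fun t => a - t) @^-1` `]b, c] = `[a - c, a - b[%classic :> set R).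
  rewrite !lebesgue_measure_itv/= !lte_fin ltrD2l ltrN2.
  by congr (if _ then _ else _); rewrite -!EFinD; congr EFin; lra.
apply/seteqP; split => x /=; rewrite !in_itv/= => /andP[h1 h2].
  by apply/andP; split; lra.
by apply/andP; split; lra.
Qed.

Lemma ge0_integral_lebesgue_subl (a : R) (f : R -> \bar R) :
  measurable_fun setT f -> (forall t, 0 <= f t)%E ->
  (\int[lambda]_t f (a - t)%R = \int[lambda]_t f t)%E.
Proof.
move=> mf f0.
have mphi := measurable_sub_cst a.
pose phi : {mfun _ >-> _} := HB.pack (fun t : measurableTypeR R => a - t : measurableTypeR R)
  (isMeasurableFun.Build _ _ _ _ _ mphi).
have := @ge0_integral_pushforward _ _ _ _ R _ mphi lambda setT f measurableT mf
  (fun y _ => f0 y).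
rewrite preimage_setT => <-.
apply: (@eq_measure_integral _ _ _ _ lambda (pushforward lambda phi)) => //= A mA _.
exact/lebesgue_measure_subl.
Qed.

Lemma measurable_tuple_sub n :
  measurable_fun setT
    (fun z : n.-tuple R * n.-tuple R => tuple_sub z.1 z.2).
Proof.
apply/measurable_fun_tnthP => i.
rewrite (_ : _ \o _ = fun z => tnth z.1 i - tnth z.2 i); last first.
  by apply/funext => z /=; rewrite tnth_mktuple.
apply: measurable_funB.
- exact: (measurableT_comp (measurable_tnth i)).
- exact: (measurableT_comp (measurable_tnth i)).
Qed.

Lemma measurable_tuple_subl n (x : n.-tuple R) :
  measurable_fun setT (tuple_sub x).
Proof.
apply/measurable_fun_tnthP => i.
rewrite (_ : _ \o _ = fun z => tnth x i - tnth z i); last first.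
  by apply/funext => z /=; rewrite tnth_mktuple.
by apply: measurable_funB => //; exact: measurable_tnth.
Qed.

Lemma ge0_integral_lebesgue_tupleS n (f : n.+1.-tuple R -> \bar R) :
  measurable_fun setT f -> (forall t, 0 <= f t)%E ->
  (\int[lebesgue_tuple R n.+1]_x f x =
   \int[lambda]_t \int[lebesgue_tuple R n]_s f (cons_pair (t, s)))%E.
Proof.
move=> mf f0.
have := @ge0_integral_pushforward _ _ (measurableTypeR R * n.-tuple R)%type
  _ R _ (@measurable_cons_pair R n)
  (lambda \x lebesgue_tuple R n)%E setT f measurableT mf (fun y _ => f0 y).
rewrite preimage_setT => /= ->.
apply: (@fubini_tonelli1 _ _ (measurableTypeR R) (n.-tuple R) R lambda
  (lebesgue_tuple R n) (f \o @cons_pair R n)) => //.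
- by apply: measurableT_comp => //; exact: measurable_cons_pair.
- by move=> x; exact: f0.
Qed.

Lemma tuple_sub_cons n (x : n.+1.-tuple R) (t : R) (s : n.-tuple R) :
  tuple_sub x (cons_pair (t, s)) =
  cons_pair (thead x - t, tuple_sub [tuple of behead x] s).
Proof.
case/tupleP: x => x0 x.
have -> : [tuple of behead [tuple of x0 :: x]] = x by apply: val_inj.
apply: eq_from_tnth => i; rewrite tnth_mktuple.
case: (unliftP ord0 i) => [j ->|->]; last by rewrite !tnth0 theadE.
by rewrite !tnthS tnth_mktuple.
Qed.

(** The invariance is inherited coordinate by coordinate, by Tonelli. *)
Lemma ge0_integral_tuple_sub n (x : n.-tuple R) (f : n.-tuple R -> \bar R) :
  measurable_fun setT f -> (forall t, 0 <= f t)%E ->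
  (\int[lebesgue_tuple R n]_y f (tuple_sub x y) =
   \int[lebesgue_tuple R n]_y f y)%E.
Proof.
elim: n x f => [|n IH] x f mf f0.
  apply: eq_integral => y _; congr f.
  exact: etrans (tuple0 _) (esym (tuple0 _)).
have mfx := measurableT_comp mf (measurable_tuple_subl x).
rewrite (ge0_integral_lebesgue_tupleS mfx (fun y => f0 _)).
rewrite (ge0_integral_lebesgue_tupleS mf f0) /=.
have mfc := measurableT_comp mf (@measurable_cons_pair R n).
transitivity (\int[lambda]_t
    (fun u => \int[lebesgue_tuple R n]_s f (cons_pair (u, s))) (thead x - t)%R)%E.
  apply: eq_integral => t _.
  under eq_integral do rewrite tuple_sub_cons.
  rewrite (IH _ (fun s => f (cons_pair (thead x - t, s))))//.
  exact: (measurableT_comp mfc (pair1_measurable _)).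
apply: (@ge0_integral_lebesgue_subl _
  (fun u => \int[lebesgue_tuple R n]_s f (cons_pair (u, s)))%E).
  apply: (@measurable_fun_fubini_tonelli_F _ _ (measurableTypeR R) (n.-tuple R)
    R (lebesgue_tuple R n) (f \o @cons_pair R n)) => // y.
  exact: f0.
by move=> t; apply: integral_ge0 => s _; exact: f0.
Qed.

End reflection_invariance.

(** * Square-integrable functions *)

Section square_modulus.
Context {R : realType}.
Implicit Types z w : R[i].

Definition normsq z : R := complex.Re z ^+ 2 + complex.Im z ^+ 2.

Lemma normsq_ge0 z : 0 <= normsq z.
Proof. by rewrite addr_ge0// sqr_ge0. Qed.

Lemma normsq_sqrt z : Num.sqrt (normsq z) ^+ 2 = normsq z.
Proof. by rewrite sqr_sqrtr// normsq_ge0. Qed.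

Lemma normsqD z w : normsq (z + w) <= 2 * normsq z + 2 * normsq w.
Proof.
case: z w => [a b] [c d]; rewrite /normsq /=.
have := sqr_ge0 (a - c); have := sqr_ge0 (b - d); nra.
Qed.

Lemma normsqZ (k : R) z : normsq (Complex k 0 * z) = k ^+ 2 * normsq z.
Proof. by case: z => [a b]; rewrite /normsq /=; ring. Qed.

Lemma normsq_norm z : normsq `|z| = normsq z.
Proof. by rewrite normc_def /normsq /= expr0n/= addr0 normsq_sqrt. Qed.

(** The reverse triangle inequality; it makes the modulus nonexpansive on L2. *)
Lemma normsq_norm_dist z w : normsq (`|z| - `|w|) <= normsq (z - w).
Proof.
have : `| `|z| - `|w| | ^+ 2 <= `|z - w| ^+ 2.
  by rewrite ler_pXn2r ?nnegrE ?normr_ge0// ler_dist_dist.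
by rewrite -!add_Re2_Im2 lecR.
Qed.

Lemma Re_mul_le z w : `|complex.Re (z * w)| <= normsq z + normsq w.
Proof.
case: z w => [a b] [c d]; rewrite /normsq /=.
have := sqr_ge0 (a - c); have := sqr_ge0 (a + c).
have := sqr_ge0 (b - d); have := sqr_ge0 (b + d).
by move=> *; rewrite ler_norml; apply/andP; split; nra.
Qed.

Lemma Im_mul_le z w : `|complex.Im (z * w)| <= normsq z + normsq w.
Proof.
case: z w => [a b] [c d]; rewrite /normsq /=.
have := sqr_ge0 (a - d); have := sqr_ge0 (a + d).
have := sqr_ge0 (b - c); have := sqr_ge0 (b + c).
by move=> *; rewrite ler_norml; apply/andP; split; nra.
Qed.

End square_modulus.

Section square_integrable.
Context {R : realType} {d : nat}.
Local Notation mu := (lebesgue_tuple R d).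
Implicit Types (f g : cfun R d).

Definition rscale (k : R) f : cfun R d := fun x => Complex k 0 * f x.

Lemma rscale0 f x : rscale 0 f x = 0.
Proof.
rewrite /rscale; case: (f x) => a b; apply/eqP; rewrite eq_complex /=.
by rewrite !mul0r subrr addr0 eqxx.
Qed.

Lemma cmeasurableD f g : cmeasurable f -> cmeasurable g -> cmeasurable (f \+ g).
Proof.
move=> [Rf If] [Rg Ig]; split.
  rewrite (_ : (fun _ => _) = (fun x => complex.Re (f x)) \+ (fun x => complex.Re (g x))).
    exact: measurable_funD.
  by apply/funext => x /=; case: (f x); case: (g x).
rewrite (_ : (fun _ => _) = (fun x => complex.Im (f x)) \+ (fun x => complex.Im (g x))).
  exact: measurable_funD.
by apply/funext => x /=; case: (f x); case: (g x).
Qed.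

Lemma cmeasurable_rscale k f : cmeasurable f -> cmeasurable (rscale k f).
Proof.
move=> [Rf If]; split.
  rewrite (_ : (fun _ => _) = (fun x => k * complex.Re (f x))).
    by apply: measurable_funM => //; exact: measurable_cst.
  by apply/funext => x; rewrite /rscale; case: (f x) => a b /=; ring.
rewrite (_ : (fun _ => _) = (fun x => k * complex.Im (f x))).
  by apply: measurable_funM => //; exact: measurable_cst.
by apply/funext => x; rewrite /rscale; case: (f x) => a b /=; ring.
Qed.

Lemma subE_rscale f g : f \- g = f \+ rscale (-1) g.
Proof.
apply/funext => x; rewrite /rscale /=.
by case: (f x) (g x) => [a b] [a' b']; apply/eqP; rewrite eq_complex /=;
  apply/andP; split; apply/eqP; ring.
Qed.

Lemma cmeasurableB f g : cmeasurable f -> cmeasurable g -> cmeasurable (f \- g).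
Proof.
by move=> mf mg; rewrite subE_rscale; apply/cmeasurableD/cmeasurable_rscale.
Qed.

Lemma measurable_normsq f : cmeasurable f ->
  measurable_fun setT (fun x => normsq (f x)).
Proof. by move=> [Rf If]; apply: measurable_funD; apply: measurable_funX. Qed.

Lemma cmeasurable_modulus f : cmeasurable f -> cmeasurable (modulus f).
Proof.
move=> mf; split.
  rewrite (_ : (fun _ => _) = (fun x => Num.sqrt (normsq (f x)))); last first.
    by apply/funext => x; rewrite /modulus (normc_def (f x)).
  apply: (measurableT_comp _ (measurable_normsq mf)).
  by apply: continuous_measurable_fun; exact: sqrt_continuous.
rewrite (_ : (fun _ => _) = cst 0); first exact: measurable_cst.
by apply/funext => x; rewrite /modulus (normc_def (f x)).
Qed.

Lemma measurable_enormsq f : cmeasurable f ->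
  measurable_fun setT (fun x => (normsq (f x))%:E).
Proof.
by move=> mf; apply/measurable_EFinP; exact: measurable_normsq.
Qed.

(** Turns every estimate below into one on the real integrand [normsq (f x)]. *)
Lemma L2normsqE f : L2normsq f = (\int[mu]_x (normsq (f x))%:E)%E.
Proof.
rewrite /L2normsq /cLnorm.
transitivity (Lnorm mu 2%:E
    (fun x => (ComplexField.Normc.normc (f x))%:E) `^ 2)%E.
  have := Lnorm_ge0 mu 2%:E (fun x => (ComplexField.Normc.normc (f x))%:E).
  case: Lnorm => [r||] //.
    by rewrite lee_fin => r0; rewrite -EFin_expe poweR_EFin powR_mulrn.
  by move=> _; rewrite poweRyr ?pnatr_eq0.
rewrite poweR_Lnorm ?pnatr_eq0//; apply: eq_integral => x _ /=.
have e : ComplexField.Normc.normc (f x) = Num.sqrt (normsq (f x)).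
  by case: (f x).
by rewrite powR_mulrn// real_normK ?num_real// e normsq_sqrt.
Qed.

Lemma L2normsq_ge0 f : (0 <= L2normsq f)%E.
Proof.
by rewrite L2normsqE; apply: integral_ge0 => x _; rewrite lee_fin normsq_ge0.
Qed.

Lemma cLfun2P f : cLfun 2%:E f <-> cmeasurable f /\ (L2normsq f < +oo)%E.
Proof.
split=> -[mf h]; split => //; move: h; rewrite /L2normsq.
  have := Lnorm_ge0 mu 2%:E (fun x => (ComplexField.Normc.normc (f x))%:E).
  rewrite -/(cLnorm 2%:E f).
  by case: cLnorm => [r||] // _ _; rewrite -EFin_expe ltry.
have := Lnorm_ge0 mu 2%:E (fun x => (ComplexField.Normc.normc (f x))%:E).
rewrite -/(cLnorm 2%:E f).
by case: cLnorm => [r||] // _; rewrite ?ltry//= mulyy.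
Qed.

Lemma L2normsqD f g : cmeasurable f -> cmeasurable g ->
  (L2normsq (f \+ g)%R <= 2%:E * L2normsq f + 2%:E * L2normsq g)%E.
Proof.
move=> mf mg; rewrite !L2normsqE.
have n0 (h : cfun R d) x : setT x -> (0 <= (normsq (h x))%:E)%E.
  by move=> _; rewrite lee_fin normsq_ge0.
rewrite -!ge0_integralZl_EFin//;
  [|exact: n0|exact: measurable_enormsq|exact: n0|exact: measurable_enormsq].
have m2 (h : cfun R d) : cmeasurable h ->
    measurable_fun setT (fun x => 2%:E * (normsq (h x))%:E)%E.
  by move=> mh; apply: measurable_funeM; exact: measurable_enormsq.
have p2 (h : cfun R d) x : setT x -> (0 <= 2%:E * (normsq (h x))%:E)%E.
  by move=> _; rewrite -EFinM lee_fin mulr_ge0// normsq_ge0.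
rewrite -ge0_integralD//; try exact: m2; try exact: p2.
apply: ge0_le_integral => //.
- by move=> x _; rewrite lee_fin normsq_ge0.
- by apply: measurable_enormsq; exact: cmeasurableD.
- by apply: emeasurable_funD; exact: m2.
- by move=> x _; rewrite -!EFinM -EFinD lee_fin normsqD.
Qed.

Lemma L2normsq_rscale k f : cmeasurable f ->
  (L2normsq (rscale k f) = (k ^+ 2)%:E * L2normsq f)%E.
Proof.
move=> mf; rewrite !L2normsqE -ge0_integralZl_EFin ?sqr_ge0//.
- by apply: eq_integral => x _; rewrite normsqZ.
- by move=> x _; rewrite lee_fin normsq_ge0.
- exact: measurable_enormsq.
Qed.

Lemma L2normsq_modulus f : L2normsq (modulus f) = L2normsq f.
Proof. by rewrite !L2normsqE; apply: eq_integral => x _; rewrite normsq_norm. Qed.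

Lemma L2normsq_modulus_dist f g : cmeasurable f -> cmeasurable g ->
  (L2normsq (modulus f \- modulus g)%R <= L2normsq (f \- g)%R)%E.
Proof.
move=> mf mg; rewrite !L2normsqE; apply: ge0_le_integral => //.
- by move=> x _; rewrite lee_fin normsq_ge0.
- by apply: measurable_enormsq; apply: cmeasurableB; exact: cmeasurable_modulus.
- by apply: measurable_enormsq; exact: cmeasurableB.
- by move=> x _; rewrite lee_fin normsq_norm_dist.
Qed.

Lemma cLfun2D f g : cLfun 2%:E f -> cLfun 2%:E g -> cLfun 2%:E (f \+ g).
Proof.
move=> /cLfun2P[mf lf] /cLfun2P[mg lg]; apply/cLfun2P; split.
  exact: cmeasurableD.
apply: le_lt_trans (L2normsqD mf mg) _.
by rewrite lte_add_pinfty// lte_mul_pinfty.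
Qed.

Lemma cLfun2_rscale k f : cLfun 2%:E f -> cLfun 2%:E (rscale k f).
Proof.
move=> /cLfun2P[mf lf]; apply/cLfun2P; split; first exact: cmeasurable_rscale.
by rewrite L2normsq_rscale// lte_mul_pinfty// lee_fin sqr_ge0.
Qed.

Lemma cLfun2B f g : cLfun 2%:E f -> cLfun 2%:E g -> cLfun 2%:E (f \- g).
Proof. by move=> ? ?; rewrite subE_rscale; apply/cLfun2D/cLfun2_rscale. Qed.

Lemma cLfun2_modulus f : cLfun 2%:E f -> cLfun 2%:E (modulus f).
Proof.
move=> /cLfun2P[mf lf]; apply/cLfun2P; split; first exact: cmeasurable_modulus.
by rewrite L2normsq_modulus.
Qed.

End square_integrable.

(** * Convolution of square-integrable functions *)

(** Positive and negative parts are integrated separately, so that Tonelli's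
theorem applies whether or not the integrals converge. *)
Lemma measurable_fun_Rintegral d1 d2 (T1 : measurableType d1)
    (T2 : measurableType d2) (R : realType)
    (m : {sigma_finite_measure set T2 -> \bar R}) (h : T1 * T2 -> R) :
  measurable_fun setT h ->
  measurable_fun setT (fun x => \int[m]_y h (x, y)).
Proof.
move=> mh; have /measurable_EFinP meh := mh.
apply: (measurableT_comp (fine_measurable measurableT)).
rewrite (_ : (fun _ => _) = fubini_F m (EFin \o h)^\+ \- fubini_F m (EFin \o h)^\-)%E.
  apply: emeasurable_funB.
    by apply: measurable_fun_fubini_tonelli_F => //; exact: measurable_funepos.
  by apply: measurable_fun_fubini_tonelli_F => //; exact: measurable_funeneg.
apply/funext => x; rewrite integralE /fubini_F /=.
by congr (_ - _)%E; apply: eq_integral => y _; rewrite !(funeposE, funenegE).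
Qed.

Section convolution.
Context {R : realType} {d : nat}.
Local Notation mu := (lebesgue_tuple R d).
Implicit Types (f g : cfun R d).

Lemma cmeasurable_convolution f g :
  cmeasurable f -> cmeasurable g -> cmeasurable (convolution f g).
Proof.
move=> [Rf If] [Rg Ig].
have m2 (u : d.-tuple R -> R) : measurable_fun setT u ->
    measurable_fun setT (fun z : d.-tuple R * d.-tuple R => u z.2).
  by move=> mu_; exact: (measurableT_comp mu_).
have ms (u : d.-tuple R -> R) : measurable_fun setT u ->
    measurable_fun setT
      (fun z : d.-tuple R * d.-tuple R => u (tuple_sub z.1 z.2)).
  by move=> mu_; exact: (measurableT_comp mu_ (@measurable_tuple_sub R d)).
split.
  apply: (@measurable_fun_Rintegral _ _ _ _ R mu (fun z =>
    complex.Re (f z.2 * g (tuple_sub z.1 z.2)))).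
  rewrite (_ : (fun _ => _) = (fun z =>
    complex.Re (f z.2) * complex.Re (g (tuple_sub z.1 z.2)) -
    complex.Im (f z.2) * complex.Im (g (tuple_sub z.1 z.2)))); last first.
    by apply/funext => z; case: (f _) (g _) => [a b] [a' b'].
  apply: measurable_funB; apply: measurable_funM.
  - exact: (m2 _ Rf).
  - exact: (ms _ Rg).
  - exact: (m2 _ If).
  - exact: (ms _ Ig).
apply: (@measurable_fun_Rintegral _ _ _ _ R mu (fun z =>
  complex.Im (f z.2 * g (tuple_sub z.1 z.2)))).
rewrite (_ : (fun _ => _) = (fun z =>
  complex.Re (f z.2) * complex.Im (g (tuple_sub z.1 z.2)) +
  complex.Im (f z.2) * complex.Re (g (tuple_sub z.1 z.2)))); last first.
  by apply/funext => z; case: (f _) (g _) => [a b] [a' b'].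
apply: measurable_funD; apply: measurable_funM.
- exact: (m2 _ Rf).
- exact: (ms _ Ig).
- exact: (m2 _ If).
- exact: (ms _ Rg).
Qed.

Lemma L2normsq_translate g x : cmeasurable g ->
  L2normsq (fun y => g (tuple_sub x y)) = L2normsq g.
Proof.
move=> mg; rewrite !L2normsqE.
apply: (ge0_integral_tuple_sub x (f := fun y => (normsq (g y))%:E)).
  exact: measurable_enormsq.
by move=> y; rewrite lee_fin normsq_ge0.
Qed.

Lemma cLfun2_translate g x : cLfun 2%:E g ->
  cLfun 2%:E (fun y => g (tuple_sub x y)).
Proof.
move=> /cLfun2P[mg lg]; apply/cLfun2P; rewrite L2normsq_translate//; split => //.
have [Rg Ig] := mg; split.
  exact: (measurableT_comp Rg (measurable_tuple_subl x)).
exact: (measurableT_comp Ig (measurable_tuple_subl x)).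
Qed.

Lemma integrable_normsq f : cLfun 2%:E f ->
  mu.-integrable setT (EFin \o (fun y => normsq (f y))).
Proof.
move=> /cLfun2P[mf lf]; apply/integrableP; split.
  exact: measurable_enormsq.
move: lf; rewrite L2normsqE; apply: le_lt_trans.
rewrite le_eqVlt; apply/orP; left; apply/eqP; apply: eq_integral => y _.
by rewrite /= ger0_norm// normsq_ge0.
Qed.

(** With [integrable_Im_mul]: 2|zw| <= |z|^2 + |w|^2 makes the integrand of a
convolution of two L2 functions integrable at every point, so that
convolution is additive as an identity of functions. *)
Lemma integrable_Re_mul f g : cLfun 2%:E f -> cLfun 2%:E g ->
  mu.-integrable setT (EFin \o (fun y => complex.Re (f y * g y))).
Proof.
move=> Lf Lg; have [[Rf If] _] := Lf; have [[Rg Ig] _] := Lg.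
apply: (@le_integrable _ _ _ mu _ measurableT _
    ((EFin \o (fun y => normsq (f y))) \+ (EFin \o (fun y => normsq (g y))))%E).
- apply/measurable_EFinP.
  rewrite (_ : (fun _ => _) = (fun z =>
    complex.Re (f z) * complex.Re (g z) - complex.Im (f z) * complex.Im (g z))).
    by apply: measurable_funB; apply: measurable_funM.
  by apply/funext => z; case: (f _) (g _) => [a b] [a' b'].
- move=> y _ /=; rewrite lee_fin [leRHS]ger0_norm; first exact: Re_mul_le.
  by rewrite addr_ge0// normsq_ge0.
- by apply: integrableD => //; exact: integrable_normsq.
Qed.

Lemma integrable_Im_mul f g : cLfun 2%:E f -> cLfun 2%:E g ->
  mu.-integrable setT (EFin \o (fun y => complex.Im (f y * g y))).
Proof.
move=> Lf Lg; have [[Rf If] _] := Lf; have [[Rg Ig] _] := Lg.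
apply: (@le_integrable _ _ _ mu _ measurableT _
    ((EFin \o (fun y => normsq (f y))) \+ (EFin \o (fun y => normsq (g y))))%E).
- apply/measurable_EFinP.
  rewrite (_ : (fun _ => _) = (fun z =>
    complex.Re (f z) * complex.Im (g z) + complex.Im (f z) * complex.Re (g z))).
    by apply: measurable_funD; apply: measurable_funM.
  by apply/funext => z; case: (f _) (g _) => [a b] [a' b'].
- move=> y _ /=; rewrite lee_fin [leRHS]ger0_norm; first exact: Im_mul_le.
  by rewrite addr_ge0// normsq_ge0.
- by apply: integrableD => //; exact: integrable_normsq.
Qed.

Lemma convolutionD f1 f2 g :
  cLfun 2%:E f1 -> cLfun 2%:E f2 -> cLfun 2%:E g ->
  convolution (f1 \+ f2) g = convolution f1 g \+ convolution f2 g.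
Proof.
move=> L1 L2 Lg; apply/funext => x; have Lgx := cLfun2_translate x Lg.
rewrite /convolution /cintegral /=.
apply/eqP; rewrite eq_complex /=; apply/andP; split; apply/eqP.
  rewrite -RintegralD//; [|exact: integrable_Re_mul..].
  by apply: eq_Rintegral => y _; rewrite mulrDl; case: (_ * _) (_ * _) => ? ? [].
rewrite -RintegralD//; [|exact: integrable_Im_mul..].
by apply: eq_Rintegral => y _; rewrite mulrDl; case: (_ * _) (_ * _) => ? ? [].
Qed.

Lemma convolution_rscale k f g : cLfun 2%:E f -> cLfun 2%:E g ->
  convolution (rscale k f) g = rscale k (convolution f g).
Proof.
move=> L1 Lg; apply/funext => x; have Lgx := cLfun2_translate x Lg.
rewrite /convolution /cintegral /rscale.
apply/eqP; rewrite eq_complex; apply/andP; split; apply/eqP => /=.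
  rewrite mul0r subr0 -RintegralZl//; last exact: integrable_Re_mul.
  by apply: eq_Rintegral => y _; rewrite -mulrA; case: (f y * _) => a b /=; ring.
rewrite mul0r addr0 -RintegralZl//; last exact: integrable_Im_mul.
by apply: eq_Rintegral => y _; rewrite -mulrA; case: (f y * _) => a b /=; ring.
Qed.

Lemma convolutionB f1 f2 g :
  cLfun 2%:E f1 -> cLfun 2%:E f2 -> cLfun 2%:E g ->
  convolution (f1 \- f2) g = convolution f1 g \- convolution f2 g.
Proof.
move=> L1 L2 Lg; rewrite !subE_rscale convolutionD//; last exact: cLfun2_rscale.
by rewrite convolution_rscale.
Qed.

Lemma modulus_rscale k f : 0 <= k ->
  modulus (rscale k f) = rscale k (modulus f).
Proof.
move=> k0; apply/funext => x; rewrite /modulus /rscale normrM.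
by congr (_ * _); rewrite ger0_norm// lecE /= eqxx.
Qed.

End convolution.

(** * Unordered sums *)

(** The inequality <= holds for every factor; applying it to the inverse factor
gives the converse. *)
Lemma ge0_esumZl (R : realType) (T : choiceType) (I : set T) (a : T -> \bar R)
    (k : R) : 0 <= k -> (forall i, I i -> 0 <= a i)%E ->
  (\esum_(i in I) (k%:E * a i) = k%:E * \esum_(i in I) a i)%E.
Proof.
have le_scale (c : R) (b : T -> \bar R) : 0 <= c -> (forall i, I i -> 0 <= b i)%E ->
    (\esum_(i in I) (c%:E * b i) <= c%:E * \esum_(i in I) b i)%E.
  move=> c0 b0; apply: ge_ereal_sup => _ [X [finX XI] <-].
  rewrite fsbig_finite//= big_seq -ge0_sume_distrr -?big_seq; last first.
    by move=> i; rewrite in_fset_set// inE => /XI/b0.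
  apply: lee_wpmul2l; first by rewrite lee_fin.
  by apply: esum_ge; exists X => //; rewrite fsbig_finite.
move=> k0 a0; apply/eqP; rewrite eq_le le_scale//=.
have [->|kn0] := eqVneq k 0.
  by rewrite mul0e esum_ge0// => i _; rewrite mul0e.
have kV0 : 0 <= k^-1 by rewrite invr_ge0.
have := le_scale k^-1 (fun i => k%:E * a i)%E kV0.
rewrite (eq_esum (b := a)); last first.
  by move=> i _; rewrite muleA -EFinM mulVf// mul1e.
move=> h; apply: (@le_trans _ _ (k%:E * (k^-1%:E * \esum_(i in I) (k%:E * a i)))%E).
  rewrite lee_wpmul2l ?lee_fin// h// => i Ii.
  by rewrite mule_ge0 ?lee_fin// a0.
by rewrite muleA -EFinM mulfV// mul1e.
Qed.

Lemma le_esum_subset (R : realType) (T : choiceType) (A B : set T)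
    (a : T -> \bar R) :
  A `<=` B -> (\esum_(i in A) a i <= \esum_(i in B) a i)%E.
Proof.
move=> AB; apply: le_ereal_sup => _ [X [finX XA] <-]; exists X => //.
by split => //; exact: subset_trans AB.
Qed.

(** * The energy remainder under a Bessel inequality *)

Section energy_remainder.
Context {R : realType} {d : nat}.
Variable Psi : set (cfun R d).
Implicit Types (f g psi : cfun R d).

Lemma energy_remainder_ge0 N f : (0 <= energy_remainder Psi N f)%E.
Proof. by apply: esum_ge0 => p _; exact: L2normsq_ge0. Qed.

Lemma energy_remainder0 f : energy_remainder Psi 0 f = L2normsq f.
Proof.
rewrite /energy_remainder.
rewrite (_ : [set _ | _] = [set [tuple] : 0.-tuple (cfun R d)]).
  by rewrite esum_set1//; exact: L2normsq_ge0.
by apply/seteqP; split => [p _|p _ []//]; exact: tuple0.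
Qed.

(** A path of length N + 1 is a first filter followed by a path of length N.
This recursion is how all properties of the energy remainder are proved. *)
Lemma energy_remainderS N f : energy_remainder Psi N.+1 f =
  (\esum_(psi in Psi) energy_remainder Psi N (modulus (convolution f psi)))%E.
Proof.
rewrite /energy_remainder esum_esum; last by move=> *; exact: L2normsq_ge0.
pose e (z : cfun R d * N.-tuple (cfun R d)) := [tuple of z.1 :: z.2].
apply: (@reindex_esum _ _ _ _ _ e); split.
- move=> [psi p] /= [Ppsi Pp] i; case: (unliftP ord0 i) => [j ->|->].
    by rewrite tnthS.
  by rewrite tnth0.
- by move=> [psi p] [psi' p'] _ _ /(congr1 val)[/= -> /val_inj ->].
- move=> p; case/tupleP: p => psi p /= Pp; exists (psi, p) => //; split => /=.
    by have := Pp ord0; rewrite tnth0.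
  by move=> i; have := Pp (lift ord0 i); rewrite tnthS.
Qed.

Hypothesis Psi_L2 : Psi `<=` cLfun 2%:E.
(** The half of the Parseval identity that does not mention the low-pass filter:
one layer does not increase the energy. *)
Hypothesis bessel : forall f, cLfun 2%:E f ->
  (\esum_(psi in Psi) L2normsq (convolution f psi) <= L2normsq f)%E.

Lemma cLfun2_convolution f psi : cLfun 2%:E f -> Psi psi ->
  cLfun 2%:E (convolution f psi).
Proof.
move=> Lf Ppsi; have /cLfun2P[mf lf] := Lf.
apply/cLfun2P; split.
  by apply: cmeasurable_convolution => //; have [] := Psi_L2 Ppsi.
apply: le_lt_trans lf; apply: le_trans (bessel Lf).
apply: esum_ge; exists [set psi]; first by split => // _ ->.
by rewrite fsbig_set1.
Qed.

Lemma cLfun2_layer f psi : cLfun 2%:E f -> Psi psi ->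
  cLfun 2%:E (modulus (convolution f psi)).
Proof. by move=> Lf Ppsi; apply/cLfun2_modulus/cLfun2_convolution. Qed.

Lemma energy_remainder_leS N f : cLfun 2%:E f ->
  (energy_remainder Psi N.+1 f <= energy_remainder Psi N f)%E.
Proof.
elim: N f => [|N IH] f Lf; rewrite energy_remainderS.
  rewrite energy_remainder0; apply: le_trans (bessel Lf).
  by apply: le_esum => psi _; rewrite energy_remainder0 L2normsq_modulus.
rewrite energy_remainderS; apply: le_esum => psi Ppsi.
exact/IH/cLfun2_layer.
Qed.

Lemma energy_remainder_antitone M N f : cLfun 2%:E f -> (M <= N)%N ->
  (energy_remainder Psi N f <= energy_remainder Psi M f)%E.
Proof.
move=> Lf; elim: N => [|N IH]; first by rewrite leqn0 => /eqP ->.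
rewrite leq_eqVlt => /predU1P[->//|]; rewrite ltnS => /IH.
exact/le_trans/energy_remainder_leS.
Qed.

Lemma energy_remainder_rscale N k f : 0 <= k -> cLfun 2%:E f ->
  energy_remainder Psi N (rscale k f) =
  ((k ^+ 2)%:E * energy_remainder Psi N f)%E.
Proof.
move=> k0; elim: N f => [|N IH] f Lf.
  by rewrite !energy_remainder0 L2normsq_rscale//; case: Lf.
rewrite !energy_remainderS -ge0_esumZl ?sqr_ge0//; last first.
  by move=> psi _; exact: energy_remainder_ge0.
apply: eq_esum => psi Ppsi.
rewrite convolution_rscale//; last exact: Psi_L2.
by rewrite modulus_rscale// IH//; exact: cLfun2_layer.
Qed.

Lemma L2normsq_layer_dist f g psi : cLfun 2%:E f -> cLfun 2%:E g -> Psi psi ->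
  (L2normsq (modulus (convolution f psi) \- modulus (convolution g psi))%R
   <= L2normsq (convolution (f \- g)%R psi))%E.
Proof.
move=> Lf Lg Ppsi; rewrite convolutionB//; last exact: Psi_L2.
by apply: L2normsq_modulus_dist; [have [] := cLfun2_convolution Lf Ppsi|
  have [] := cLfun2_convolution Lg Ppsi].
Qed.

(** The square root of the energy remainder is 1-Lipschitz for the L2 norm; this
is the form of that fact that needs no square roots and is proved by a direct
induction on the depth. *)
Lemma energy_remainder_near N f g : cLfun 2%:E f -> cLfun 2%:E g ->
  (energy_remainder Psi N f <=
   2%:E * energy_remainder Psi N g + 2%:E * L2normsq (f \- g)%R)%E.
Proof.
have W0 N' h i : Psi i -> (0 <= 2%:E * energy_remainder Psi N' (h i))%E.
  by move=> _; rewrite mule_ge0// energy_remainder_ge0.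
have L0 h i : Psi i -> (0 <= 2%:E * L2normsq (h i : cfun R d))%E.
  by move=> _; rewrite mule_ge0// L2normsq_ge0.
elim: N f g => [|N IH] f g Lf Lg.
  rewrite !energy_remainder0 {1}(_ : f = g \+ (f \- g)); last first.
    by apply/funext => x /=; rewrite addrC subrK.
  by apply: L2normsqD; [case: Lg|apply: cmeasurableB; [case: Lf|case: Lg]].
rewrite !energy_remainderS.
apply: (@le_trans _ _ (\esum_(psi in Psi)
    (2%:E * energy_remainder Psi N (modulus (convolution g psi)) +
     2%:E * L2normsq (convolution (f \- g)%R psi))%E)).
  apply: le_esum => psi Ppsi.
  apply: le_trans (IH _ (modulus (convolution g psi)) _ _) _;
    [exact: cLfun2_layer..|].
  by rewrite leeD2l// lee_wpmul2l// L2normsq_layer_dist.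
rewrite esumD; [|exact: W0|exact: L0].
rewrite !ge0_esumZl//; last 2 first.
- by move=> psi _; exact: L2normsq_ge0.
- by move=> psi _; exact: energy_remainder_ge0.
by rewrite leeD2l// lee_wpmul2l// bessel//; exact: cLfun2B.
Qed.

End energy_remainder.

(** * Weighted series of bounded sequences in L2 *)

Section weighted_series.
Context {R : realType}.
Implicit Types (c a : nat -> R).

(** Cauchy-Schwarz for sqrt(c_j) and sqrt(c_j) a_j. *)
Lemma weighted_cauchy_schwarz c a m n : (forall j, 0 <= c j) ->
  (\sum_(m <= j < n) c j * a j) ^+ 2 <=
  (\sum_(m <= j < n) c j) * \sum_(m <= j < n) c j * a j ^+ 2.
Proof.
move=> c0; elim: (index_iota m n) => [|j s]; first by rewrite !big_nil expr2 mul0r.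
rewrite !big_cons.
have : 0 <= \sum_(i <- s) c i by apply: sumr_ge0.
have : 0 <= \sum_(i <- s) c i * a i ^+ 2.
  by apply: sumr_ge0 => i _; rewrite mulr_ge0// sqr_ge0.
move: (\sum_(i <- s) c i * a i) (\sum_(i <- s) c i)
  (\sum_(i <- s) c i * a i ^+ 2) => A S B B0 S0 IH.
have cj0 := c0 j.
(* the cross term of the square of A + c_j a_j, by A^2 <= S B and AM-GM *)
suff : 2 * A * a j <= S * a j ^+ 2 + B by move=> ?; nra.
have [S_eq0|S_neq0] := eqVneq S 0.
  have /eqP -> : A == 0.
    by rewrite -sqrf_eq0 eq_le sqr_ge0 andbT (le_trans IH)// S_eq0 mul0r.
  by rewrite S_eq0 mulr0 !mul0r add0r.
have S_gt0 : 0 < S by rewrite lt_neqAle eq_sym S_neq0.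
rewrite -(ler_pM2l S_gt0).
have := sqr_ge0 (S * a j - A); nra.
Qed.

Lemma cvgn_weighted_series c a (K M : R) : (forall j, 0 <= c j) ->
  (forall n, \sum_(0 <= j < n) c j <= K) ->
  (forall n, \sum_(0 <= j < n) c j * a j ^+ 2 <= M) ->
  cvgn (fun n => \sum_(0 <= j < n) c j * a j).
Proof.
move=> c0 cK aM.
apply: (@normed_cvg _ R^o (fun j => c j * a j)).
suff : cvgn (series (fun j => `|c j * a j|)) by [].
apply: nondecreasing_is_cvgn.
  by apply/nondecreasing_seqP => n; rewrite seriesSr lerDl.
exists (K + M) => _ [n _ <-]; rewrite seriesEnat /mk_sequence.
apply: le_trans (lerD (cK n) (aM n)); rewrite -big_split /=.
apply: ler_sum => j _; rewrite normrM ger0_norm// -[X in _ <= X + _]mulr1 -mulrDr.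
rewrite ler_wpM2l// -[a j ^+ 2]real_normK ?num_real//.
have := sqr_ge0 (`|a j| - 1); have := normr_ge0 (a j); nra.
Qed.

End weighted_series.

Section L2_series.
Context {R : realType} {d : nat}.
Local Notation mu := (lebesgue_tuple R d).
Variables (c : nat -> R) (g : nat -> cfun R d).

Definition partial_sum n : cfun R d :=
  fun x => \sum_(0 <= j < n) rscale (c j) (g j) x.

Lemma partial_sum0 x : partial_sum 0 x = 0.
Proof. by rewrite /partial_sum big_geq. Qed.

Lemma partial_sumS n :
  partial_sum n.+1 = partial_sum n \+ rscale (c n) (g n).
Proof. by apply/funext => x; rewrite /partial_sum big_nat_recr. Qed.

Lemma Re_partial_sum n x : complex.Re (partial_sum n x) =
  \sum_(0 <= j < n) c j * complex.Re (g j x).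
Proof.
rewrite /partial_sum (big_morph (@complex.Re R) (id1 := 0) (op1 := +%R))//.
  by apply: eq_bigr => j _; rewrite /rscale; case: (g j x) => a b /=; ring.
by case=> a b [].
Qed.

Lemma Im_partial_sum n x : complex.Im (partial_sum n x) =
  \sum_(0 <= j < n) c j * complex.Im (g j x).
Proof.
rewrite /partial_sum (big_morph (@complex.Im R) (id1 := 0) (op1 := +%R))//.
  by apply: eq_bigr => j _; rewrite /rscale; case: (g j x) => a b /=; ring.
by case=> a b [].
Qed.

Hypothesis g_L2 : forall j, cLfun 2%:E (g j).

Lemma cLfun2_partial_sum n : cLfun 2%:E (partial_sum n).
Proof.
elim: n => [|n IH]; last first.
  by rewrite partial_sumS; apply: cLfun2D => //; exact: cLfun2_rscale.
have -> : partial_sum 0 = rscale 0 (g 0%N).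
  by apply/funext => x; rewrite partial_sum0 rscale0.
exact: cLfun2_rscale.
Qed.

Variables (T : nat -> R) (C : R).
Hypothesis c_ge0 : forall j, 0 <= c j.
Hypothesis T_gt0 : forall n, 0 < T n.
(** The numbers T n are, up to a constant, the tails of the series of weights;
asking for a recursion avoids infinite sums of reals. *)
Hypothesis T_tail : forall n, T n = c n + T n.+1.
Hypothesis g_le : forall j, (L2normsq (g j) <= C%:E)%E.

Lemma sum_weights m n : (m <= n)%N -> \sum_(m <= j < n) c j = T m - T n.
Proof.
elim: n => [|n IH]; first by rewrite leqn0 => /eqP ->; rewrite big_geq// subrr.
rewrite leq_eqVlt => /predU1P[->|]; first by rewrite big_geq// subrr.
by rewrite ltnS => mn; rewrite big_nat_recr//= IH// (T_tail n); ring.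
Qed.

Lemma sum_weights_le m n : \sum_(m <= j < n) c j <= T m.
Proof.
have [mn|nm] := leqP m n; last by rewrite big_geq ?(ltnW nm)// ltW.
by rewrite sum_weights// gerBl ltW.
Qed.

(** Dominates the series: where G is finite the partial sums are Cauchy, with the
squared distance of the n-th one to the limit at most T n * G x. *)
Let G x : \bar R := (\sum_(j <oo) (c j * normsq (g j x))%:E)%E.

Let G_term_ge0 j x : (0 <= (c j * normsq (g j x))%:E)%E.
Proof. by rewrite lee_fin mulr_ge0// normsq_ge0. Qed.

Let measurable_term j : measurable_fun setT (fun x => (c j * normsq (g j x))%:E).
Proof.
apply/measurable_EFinP; apply: measurable_funM => //.
by apply: measurable_normsq; case: (g_L2 j).
Qed.

Let G_ge0 x : (0 <= G x)%E.
Proof. by apply: nneseries_ge0 => j _ _; exact: G_term_ge0. Qed.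

Let measurable_G : measurable_fun setT G.
Proof.
apply: (ge0_emeasurable_sum (P := predT)) => [j x _ _|j _].
  exact: G_term_ge0.
exact: measurable_term.
Qed.

Let C_ge0 : 0 <= C.
Proof. by rewrite -lee_fin (le_trans _ (g_le 0))// L2normsq_ge0. Qed.

Let integral_G : (\int[mu]_x G x <= (T 0%N * C)%:E)%E.
Proof.
rewrite integral_nneseries//.
apply: lime_le.
  apply: is_cvg_nneseries => j _ _; apply: integral_ge0 => x _.
  exact: G_term_ge0.
apply: nearW => n.
apply: (@le_trans _ _ (\sum_(0 <= j < n) (c j * C)%:E)%E).
  apply: lee_sum => j _.
  rewrite (_ : (\int[mu]_x _)%E = ((c j)%:E * L2normsq (g j))%E).
    by rewrite EFinM lee_wpmul2l// lee_fin.
  rewrite L2normsqE -ge0_integralZl_EFin//.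
  - by move=> x _; rewrite lee_fin normsq_ge0.
  - by apply: measurable_enormsq; case: (g_L2 j).
rewrite sumEFin lee_fin -mulr_suml ler_wpM2r//.
exact: sum_weights_le.
Qed.

Let sum_le_G m n x : (G x < +oo)%E ->
  \sum_(m <= j < n) c j * normsq (g j x) <= fine (G x).
Proof.
move=> Gx; rewrite -lee_fin fineK; last by rewrite ge0_fin_numE.
rewrite -sumEFin.
have [mn|nm] := leqP m n; last by rewrite big_geq ?(ltnW nm)// G_ge0.
apply: (@le_trans _ _ (\sum_(0 <= j < n) (c j * normsq (g j x))%:E)%E).
  by rewrite (big_cat_nat (leq0n m) mn)/= leeDr// sume_ge0.
exact: (nneseries_lim_ge (P := predT)).
Qed.

Let Re_sq_le m n x : \sum_(m <= j < n) c j * complex.Re (g j x) ^+ 2 <=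
  \sum_(m <= j < n) c j * normsq (g j x).
Proof. by apply: ler_sum => j _; rewrite ler_wpM2l// lerDl sqr_ge0. Qed.

Let Im_sq_le m n x : \sum_(m <= j < n) c j * complex.Im (g j x) ^+ 2 <=
  \sum_(m <= j < n) c j * normsq (g j x).
Proof. by apply: ler_sum => j _; rewrite ler_wpM2l// lerDr sqr_ge0. Qed.

Let A : set (d.-tuple R) := [set x | (G x < +oo)%E].

Let measurable_A : measurable A.
Proof.
have := emeasurable_fun_infty_o measurableT measurable_G +oo%E.
by rewrite setTI.
Qed.

Let partial_sum_dist m n x : A x -> (m <= n)%N ->
  normsq (partial_sum n x - partial_sum m x) <= T m * fine (G x).
Proof.
move=> Ax mn.
have -> : normsq (partial_sum n x - partial_sum m x) =
    (\sum_(m <= j < n) c j * complex.Re (g j x)) ^+ 2 +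
    (\sum_(m <= j < n) c j * complex.Im (g j x)) ^+ 2.
  rewrite /normsq; congr (_ ^+ 2 + _ ^+ 2).
    rewrite (_ : complex.Re _ =
      complex.Re (partial_sum n x) - complex.Re (partial_sum m x)); last first.
      by case: (partial_sum n x) (partial_sum m x) => ? ? [].
    by rewrite !Re_partial_sum (big_cat_nat (leq0n m) mn) addrC addKr.
  rewrite (_ : complex.Im _ =
    complex.Im (partial_sum n x) - complex.Im (partial_sum m x)); last first.
    by case: (partial_sum n x) (partial_sum m x) => ? ? [].
  by rewrite !Im_partial_sum (big_cat_nat (leq0n m) mn) addrC addKr.
have hR := @weighted_cauchy_schwarz R c (fun j => complex.Re (g j x)) m n c_ge0.
have hI := @weighted_cauchy_schwarz R c (fun j => complex.Im (g j x)) m n c_ge0.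
apply: le_trans (lerD hR hI) _; rewrite -mulrDr -big_split /=.
under [X in _ * X <= _]eq_bigr do rewrite -mulrDr.
apply: ler_pM.
- exact: sumr_ge0.
- by apply: sumr_ge0 => j _; rewrite mulr_ge0// normsq_ge0.
- exact: sum_weights_le.
- exact: sum_le_G.
Qed.

Let Re_cvg x : A x -> cvgn (fun n => complex.Re (partial_sum n x)).
Proof.
move=> Ax; under eq_fun do rewrite Re_partial_sum.
apply: (@cvgn_weighted_series _ _ _ (T 0%N) (fine (G x))) => // n.
  exact: sum_weights_le.
exact: le_trans (Re_sq_le _ _ _) (sum_le_G _ _ Ax).
Qed.

Let Im_cvg x : A x -> cvgn (fun n => complex.Im (partial_sum n x)).
Proof.
move=> Ax; under eq_fun do rewrite Im_partial_sum.
apply: (@cvgn_weighted_series _ _ _ (T 0%N) (fine (G x))) => // n.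
  exact: sum_weights_le.
exact: le_trans (Im_sq_le _ _ _) (sum_le_G _ _ Ax).
Qed.

Let measurable_lim (s : nat -> d.-tuple R -> R) :
  (forall n, measurable_fun setT (s n)) ->
  (forall x, A x -> cvgn (s ^~ x)) ->
  measurable_fun setT (fun x => limn (s ^~ x) * \1_A x).
Proof.
move=> ms cs; apply: (@measurable_fun_cvg _ _ _ _ (fun n x => s n x * \1_A x)).
  by move=> n; apply: measurable_funM => //; exact: measurable_indic.
move=> x _; have [Ax|nAx] := pselect (A x).
  by rewrite indicE mem_set// mulr1; under eq_fun do rewrite mulr1; exact: cs.
rewrite indicE memNset// mulr0; under eq_fun do rewrite mulr0.
exact: cvg_cst.
Qed.

(** The sum is defined as the pointwise limit on the set where G is finite and as
0 elsewhere.  Since T n is positive, the estimate by T n * G holds trivially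
where G is infinite, so that no null sets enter; it is then integrated. *)
Lemma L2_series : exists2 h : cfun R d, cLfun 2%:E h &
  forall n, (L2normsq (h \- partial_sum n)%R <= (T n * (T 0%N * C))%:E)%E.
Proof.
pose re x := limn (fun n => complex.Re (partial_sum n x)) * \1_A x.
pose im x := limn (fun n => complex.Im (partial_sum n x)) * \1_A x.
pose h x := Complex (re x) (im x).
have mS n : cmeasurable (partial_sum n) by case: (cLfun2_partial_sum n).
have mh : cmeasurable h.
  split; apply: measurable_lim => //.
  - by move=> n; case: (mS n).
  - by move=> n; case: (mS n).
have h_dist n x : ((normsq (h x - partial_sum n x))%:E <= (T n)%:E * G x)%E.
  have [Ax|nAx] := pselect (A x); last first.
    have -> : G x = +oo%E.
      by apply/eqP; rewrite -leye_eq leNgt; exact/negP.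
    by rewrite gt0_muley ?lte_fin// leey.
  rewrite -(fineK (_ : G x \is a fin_num)) ?ge0_fin_numE// -EFinM lee_fin.
  have hx : h x = Complex (limn (fun n => complex.Re (partial_sum n x)))
                          (limn (fun n => complex.Im (partial_sum n x))).
    by rewrite /h /re /im indicE mem_set// !mulr1.
  have sqE (z w : R[i]) : normsq (z - w) =
      (complex.Re z - complex.Re w) * (complex.Re z - complex.Re w) +
      (complex.Im z - complex.Im w) * (complex.Im z - complex.Im w).
    by case: z w => [? ?] [? ?]; rewrite /normsq !expr2.
  have hlim : normsq (partial_sum m x - partial_sum n x) @[m --> \oo] -->
      normsq (h x - partial_sum n x).
    rewrite hx sqE; under eq_fun do rewrite sqE.
    apply: cvgD; apply: cvgM; (apply: cvgB; last exact: cvg_cst).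
    - exact: Re_cvg.
    - exact: Re_cvg.
    - exact: Im_cvg.
    - exact: Im_cvg.
  rewrite -(cvg_lim _ hlim)//; apply: limr_le.
    by apply/cvg_ex; exists (normsq (h x - partial_sum n x)).
  by exists n => // m /= nm; exact: partial_sum_dist.
have h_le n : (L2normsq (h \- partial_sum n)%R <= (T n * (T 0%N * C))%:E)%E.
  rewrite L2normsqE.
  apply: (@le_trans _ _ (\int[mu]_x ((T n)%:E * G x))%E).
    apply: ge0_le_integral => //.
    - by move=> x _; rewrite lee_fin normsq_ge0.
    - by apply: measurable_enormsq; exact: cmeasurableB.
    - exact: measurable_funeM.
    - by move=> x _; exact: h_dist.
  rewrite (ge0_integralZl_EFin mu measurableT (fun x _ => G_ge0 x)
    measurable_G (ltW (T_gt0 n))).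
  by rewrite [leRHS]EFinM lee_wpmul2l// lee_fin ltW.
exists h => //; apply/cLfun2P; split => //.
apply: le_lt_trans (ltry (T 0%N * (T 0%N * C))).
apply: le_trans (h_le 0%N).
rewrite !L2normsqE le_eqVlt; apply/orP; left; apply/eqP.
by apply: eq_integral => x _; rewrite /= partial_sum0 subr0.
Qed.

End L2_series.

(** * Energy seen by a part of the filters *)

Section layer_energy.
Context {R : realType} {d : nat}.
Variable Psi : set (cfun R d).
Hypothesis Psi_L2 : Psi `<=` cLfun 2%:E.
Hypothesis bessel : forall f, cLfun 2%:E f ->
  (\esum_(psi in Psi) L2normsq (convolution f psi) <= L2normsq f)%E.
Variable Phi : set (cfun R d).
Hypothesis sub_Phi : Phi `<=` Psi.
Implicit Types (f g u : cfun R d).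

Local Notation layer_energy f :=
  (\esum_(psi in Phi) L2normsq (convolution f psi))%E.

Lemma layer_energy_le f : cLfun 2%:E f -> (layer_energy f <= L2normsq f)%E.
Proof. by move=> Lf; apply: le_trans (bessel Lf); exact: le_esum_subset. Qed.

Lemma layer_energyD f g : cLfun 2%:E f -> cLfun 2%:E g ->
  (layer_energy (f \+ g)%R <= 2%:E * layer_energy f + 2%:E * layer_energy g)%E.
Proof.
move=> Lf Lg; rewrite -!ge0_esumZl//; try by move=> *; exact: L2normsq_ge0.
rewrite -esumD; try by move=> *; rewrite mule_ge0// L2normsq_ge0.
apply: le_esum => psi /sub_Phi Ppsi; rewrite convolutionD//; last exact: Psi_L2.
have [mf _] := cLfun2_convolution Psi_L2 bessel Lf Ppsi.
have [mg _] := cLfun2_convolution Psi_L2 bessel Lg Ppsi.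
exact: L2normsqD.
Qed.

Lemma layer_energy_rscale k f : cLfun 2%:E f ->
  (layer_energy (rscale k f) = (k ^+ 2)%:E * layer_energy f)%E.
Proof.
move=> Lf; rewrite -ge0_esumZl ?sqr_ge0//; last first.
  by move=> *; exact: L2normsq_ge0.
apply: eq_esum => psi /sub_Phi Ppsi.
have [mf _] := cLfun2_convolution Psi_L2 bessel Lf Ppsi.
by rewrite convolution_rscale ?L2normsq_rscale//; exact: Psi_L2.
Qed.

(** Splitting off the first term costs a factor 2 for it and for the rest, and the
rest satisfies the same bound with B / 4: 2 B + 2 (4 (B / 4)) = 4 B. *)
Lemma layer_energy_partial_sum (c : nat -> R) (g : nat -> cfun R d) (B : R) n :
  0 <= B -> (forall j, cLfun 2%:E (g j)) ->
  (forall j, (layer_energy (rscale (c j) (g j)) <= (B * 4^-1 ^+ j)%:E)%E) ->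
  (layer_energy (partial_sum c g n) <= (4 * B)%:E)%E.
Proof.
elim: n c g B => [|n IH] c g B B0 Lg gB.
  have -> : partial_sum c g 0 = rscale 0 (g 0%N).
    by apply/funext => x; rewrite partial_sum0 rscale0.
  by rewrite layer_energy_rscale// expr0n mul0e lee_fin mulr_ge0.
have -> : partial_sum c g n.+1 =
    rscale (c 0%N) (g 0%N) \+ partial_sum (c \o succn) (g \o succn) n.
  by apply/funext => x; rewrite /partial_sum big_nat_recl.
apply: (le_trans (layer_energyD _ _)).
- exact: cLfun2_rscale.
- by apply: cLfun2_partial_sum => j; exact: Lg.
apply: (@le_trans _ _ (2%:E * B%:E + 2%:E * (4 * (B / 4))%:E)%E); last first.
  by rewrite -!EFinM -EFinD lee_fin; lra.
apply: leeD; rewrite lee_wpmul2l//.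
  by have := gB 0%N; rewrite expr0 mulr1.
apply: IH => [|j|j]; [lra|exact: Lg|].
by have := gB j.+1; rewrite exprS mulrA.
Qed.

(** Inside Phi the continuity of the remaining N layers is used; outside Phi these
layers are bounded by the energy that enters them. *)
Lemma energy_remainder_layer N u f : cLfun 2%:E u -> cLfun 2%:E f ->
  (energy_remainder Psi N.+1 u <=
   2%:E * energy_remainder Psi N.+1 f + 2%:E * layer_energy (u \- f)%R +
   \esum_(psi in Psi `\` Phi) L2normsq (convolution u psi))%E.
Proof.
move=> Lu Lf; rewrite !energy_remainderS.
have W0 g psi : (0 <= energy_remainder Psi N (modulus (convolution g psi)))%E.
  exact: energy_remainder_ge0.
rewrite (esumID Phi) => [|psi _]; last exact: W0.
rewrite (setIidr sub_Phi) -setDE; apply: leeD; last first.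
  apply: le_esum => psi [Ppsi _].
  rewrite -(L2normsq_modulus (convolution u psi)) -(energy_remainder0 Psi).
  exact: (energy_remainder_antitone Psi_L2 bessel
    (cLfun2_layer Psi_L2 bessel Lu Ppsi) (leq0n N)).
apply: (@le_trans _ _ (\esum_(psi in Phi)
    (2%:E * energy_remainder Psi N (modulus (convolution f psi)) +
     2%:E * L2normsq (convolution (u \- f)%R psi))%E)).
  apply: le_esum => psi /sub_Phi Ppsi.
  apply: le_trans (energy_remainder_near Psi_L2 bessel N
    (cLfun2_layer Psi_L2 bessel Lu Ppsi) (cLfun2_layer Psi_L2 bessel Lf Ppsi)) _.
  by rewrite leeD2l// lee_wpmul2l// (L2normsq_layer_dist Psi_L2 bessel).
rewrite esumD.
- rewrite !ge0_esumZl//.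
  + by apply: leeD => //; rewrite lee_wpmul2l//; exact: le_esum_subset.
  + by move=> psi _; exact: L2normsq_ge0.
- by move=> psi _; rewrite mule_ge0.
- by move=> psi _; rewrite mule_ge0// L2normsq_ge0.
Qed.

End layer_energy.

(** * Energy remainder of a superposition *)

Lemma partial_sum_except (R : realType) (d : nat) (c : nat -> R)
    (g : nat -> cfun R d) l n : (l < n)%N ->
  partial_sum c g n =
  partial_sum (fun j => if j == l then 0 else c j) g n \+ rscale (c l) (g l).
Proof.
move=> ln; apply/funext => x; rewrite /partial_sum /= !big_mkord.
rewrite (bigD1 (Ordinal ln))//= [in RHS](bigD1 (Ordinal ln))//= eqxx.
rewrite rscale0 add0r addrC; congr (_ + _); apply: eq_bigr => i il.
rewrite ifN//; apply: contraNneq il => il.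
Qed.

Section superposition.
Context {R : realType} {d : nat}.
Variable Psi : set (cfun R d).
Hypothesis Psi_L2 : Psi `<=` cLfun 2%:E.
Hypothesis bessel : forall f, cLfun 2%:E f ->
  (\esum_(psi in Psi) L2normsq (convolution f psi) <= L2normsq f)%E.

(** The summand c_l g_l transmits its energy remainder to f_0 + h.  The number B
bounds all that Phi sees of the other terms and all that g_l leaves outside
Phi; the error is quadratic in the amplitudes, whence the factor r^2. *)
Lemma energy_remainder_superposition (Phi : set (cfun R d)) (f0 h : cfun R d)
    (g : nat -> cfun R d) (c : nat -> R) (r B w : R) (l N : nat) :
  Phi `<=` Psi -> cLfun 2%:E f0 -> cLfun 2%:E h -> (forall j, cLfun 2%:E (g j)) ->
  0 < r -> 0 < B -> (forall j, c j = r * 8^-1 ^+ j) ->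
  (forall e : R, 0 < e ->
    exists2 n, (l < n)%N & (L2normsq (h \- partial_sum c g n)%R <= e%:E)%E) ->
  (\esum_(psi in Phi) L2normsq (convolution f0 psi) <= B%:E)%E ->
  (forall j, j != l ->
    \esum_(psi in Phi) L2normsq (convolution (g j) psi) <= B%:E)%E ->
  (\esum_(psi in Psi `\` Phi) L2normsq (convolution (g l) psi) <= B%:E)%E ->
  (w%:E <= energy_remainder Psi N.+1 (g l))%E ->
  (((w - B) * c l ^+ 2 - (4 + 40 * r ^+ 2) * B)%:E <=
    2%:E * energy_remainder Psi N.+1 (f0 \+ h)%R)%E.
Proof.
move=> sub_Phi Lf0 Lh Lg r0 B0 cE approx Qf0 Qg Qout Wg.
have c0 j : 0 <= c j by rewrite cE mulr_ge0 ?exprn_ge0// ltW.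
pose c' j := if j == l then 0 else c j.
(* h minus its l-th term is the series with weights c', up to a tail *)
pose u := rscale (c l) (g l).
have Lu : cLfun 2%:E u by exact: cLfun2_rscale.
have LfE : cLfun 2%:E (f0 \+ h) by exact: cLfun2D.
pose Q f := (\esum_(psi in Phi) L2normsq (convolution f psi))%E.
have rB0 : 0 <= r ^+ 2 * B by rewrite mulr_ge0 ?sqr_ge0// ltW.
have Qsum n : (Q (partial_sum c' g n) <= (4 * (r ^+ 2 * B))%:E)%E.
  apply: (layer_energy_partial_sum Psi_L2 bessel sub_Phi) => // j.
  rewrite (layer_energy_rscale Psi_L2 bessel sub_Phi)// /c'.
  case: ifPn => [_|jl].
    by rewrite expr0n mul0e lee_fin mulr_ge0// exprn_ge0.
  apply: le_trans (lee_wpmul2l _ (Qg _ jl)) _; first by rewrite lee_fin sqr_ge0.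
  rewrite -EFinM lee_fin cE exprMn mulrAC ler_wpM2l// exprAC.
  by apply: lerXn2r; rewrite ?nnegrE; lra.
have Qh : (Q (h \- u)%R <= (10 * (r ^+ 2 * B))%:E)%E.
  have [n ln hn] := approx (r ^+ 2 * B) ltac:(by rewrite mulr_gt0// exprn_gt0).
  have -> : h \- u = (h \- partial_sum c g n) \+ partial_sum c' g n.
    apply/funext => x; rewrite (partial_sum_except c g ln) /= opprD.
    by rewrite addrA addrAC addrNK.
  have Lc' : cLfun 2%:E (partial_sum c' g n) by exact: cLfun2_partial_sum.
  have Lhn : cLfun 2%:E (h \- partial_sum c g n).
    by apply: cLfun2B => //; exact: cLfun2_partial_sum.
  apply: le_trans (layer_energyD Psi_L2 bessel sub_Phi Lhn Lc') _.
  apply: (@le_trans _ _ (2%:E * (r ^+ 2 * B)%:E +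
      2%:E * (4 * (r ^+ 2 * B))%:E)%E); last first.
    by rewrite -!EFinM -EFinD lee_fin; lra.
  apply: leeD; apply: lee_wpmul2l => //; last exact: Qsum.
  exact: le_trans (layer_energy_le bessel sub_Phi Lhn) hn.
have Qr : (Q (u \- (f0 \+ h))%R <= ((2 + 20 * r ^+ 2) * B)%:E)%E.
  have -> : u \- (f0 \+ h) = rscale (-1) (f0 \+ (h \- u)).
    apply/funext => x; rewrite /rscale /=.
    by case: (u x) (f0 x) (h x) => [? ?] [? ?] [? ?]; apply/eqP;
      rewrite eq_complex /=; apply/andP; split; apply/eqP; ring.
  have Lhu : cLfun 2%:E (h \- u) by exact: cLfun2B.
  rewrite /Q (layer_energy_rscale Psi_L2 bessel sub_Phi); last exact: cLfun2D.
  rewrite sqrrN expr1n mul1e.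
  apply: le_trans (layer_energyD Psi_L2 bessel sub_Phi Lf0 Lhu) _.
  apply: (@le_trans _ _ (2%:E * B%:E + 2%:E * (10 * (r ^+ 2 * B))%:E)%E).
    by apply: leeD; apply: lee_wpmul2l => //; exact: Qh.
  by rewrite -!EFinM -EFinD lee_fin; lra.
have := energy_remainder_layer Psi_L2 bessel sub_Phi N Lu LfE.
rewrite energy_remainder_rscale//.
have Wlow : ((c l ^+ 2 * w)%:E <= (c l ^+ 2)%:E * energy_remainder Psi N.+1 (g l))%E.
  by rewrite EFinM lee_wpmul2l// lee_fin sqr_ge0.
have Qu : (\esum_(psi in Psi `\` Phi) L2normsq (convolution u psi) <=
    (c l ^+ 2 * B)%:E)%E.
  rewrite (layer_energy_rscale Psi_L2 bessel (@subDsetl _ Psi Phi))//.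
  by rewrite [X in (_ <= X)%E]EFinM lee_wpmul2l// lee_fin sqr_ge0.
move=> /(le_trans Wlow) {Wlow} low.
have {}low : ((c l ^+ 2 * w)%:E <= 2%:E * energy_remainder Psi N.+1 (f0 \+ h)%R +
    (2 * ((2 + 20 * r ^+ 2) * B) + c l ^+ 2 * B)%:E)%E.
  apply: le_trans low _; rewrite (EFinD (2 * _)) addeA.
  apply: leeD => //; rewrite leeD2l// (EFinM 2); exact: lee_wpmul2l.
rewrite -leeBlDr// -EFinB in low.
apply: le_trans low; rewrite lee_fin le_eqVlt; apply/orP; left; apply/eqP; ring.
Qed.

End superposition.

Section scales.
Context {R : realType}.
Variable E : nat -> R.

Lemma exists_scales : 0 < E 1%N -> E @ \oo --> (0 : R) ->
  exists k : nat -> nat,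
    [/\ {homo k : i j / (i < j)%N}, forall l, (l < k l)%N &
        forall l N, (k l <= N)%N -> E N <= 64^-1 ^+ l.+1 * E 1%N].
Proof.
move=> E1 E0.
have small l : exists M, forall N, (M <= N)%N -> E N <= 64^-1 ^+ l.+1 * E 1%N.
  have e0 : 0 < 64^-1 ^+ l.+1 * E 1%N by rewrite mulr_gt0// exprn_gt0.
  have /cvgrPdist_le /(_ _ e0)[M _ HM] := E0.
  exists M => N MN; have := HM N MN; rewrite sub0r normrN.
  exact/le_trans/ler_norm.
have [M HM] := choice small.
pose k l := (\sum_(0 <= i < l.+1) (M i).+1)%N.
have kS l : (k l.+1 = k l + (M l.+1).+1)%N by rewrite /k big_nat_recr.
have k_ge l : ((M l).+1 <= k l)%N by rewrite /k big_nat_recr//= leq_addl.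
exists k; split.
- by apply: homo_ltn => [i j n|i]; [exact: ltn_trans|rewrite kS -addn1 leq_add2l].
- elim=> [|l IH]; first exact: leq_ltn_trans (k_ge 0%N).
  by rewrite kS addnS ltnS (leq_trans IH)// leq_addr.
- by move=> l N kN; apply: HM; apply: leq_trans kN; apply: leq_trans (k_ge l).
Qed.

(** For the least l with N <= k_l, either l = 0, or N exceeds k_(l-1) and the
choice of k_(l-1) applies. *)
Lemma exists_scale (k : nat -> nat) N : (0 < N)%N ->
  (forall M N, (0 < M)%N -> (M <= N)%N -> E N <= E M) ->
  (forall l, (l < k l)%N) ->
  (forall l N, (k l <= N)%N -> E N <= 64^-1 ^+ l.+1 * E 1%N) ->
  exists2 l, (N <= k l)%N & E N <= 64^-1 ^+ l * E 1%N.
Proof.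
move=> N0 Emono k_gt kE.
have ex : exists l, (N <= k l)%N by exists N; exact: ltnW.
have Nk := ex_minnP ex; case: Nk => l Nl lmin; exists l => //.
case: l => [|l] in Nl lmin *; first by rewrite expr0 mul1r Emono.
apply: kE; rewrite leqNgt; apply/negP => /ltnW /lmin.
by rewrite ltnn.
Qed.

End scales.

(** * Signals with a prescribed slow decay of the energy remainder *)

Theorem theorem2p2 (R : realType) (d : nat) (d_gt0 : (0 < d)%N)
  (chi : cfun R d) (Psi : set (cfun R d))
  (chi_L1L2 : (cLfun 1%:E `&` cLfun 2%:E) chi)
  (Psi_L1L2 : Psi `<=` cLfun 1%:E `&` cLfun 2%:E)
  (filters_distinct : ae_distinct (chi |` Psi))
  (filters_infinite : ([set: nat] #= chi |` Psi)%card)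
  (filters_Parseval : semi_discrete_Parseval_frame chi Psi)
  (F : nat -> cfun R d) (F_L2 : forall m, cLfun 2%:E (F m))
  (delta : R) (delta_gt0 : 0 < delta)
  (hyp : forall eta : nat -> R, (forall k, 0 < eta k) ->
    exists (Psi_ : nat -> set (cfun R d)) (m : nat -> nat),
      [/\ forall k, finite_set (Psi_ k),
          forall k, Psi_ k `<=` Psi,
          {homo m : i j / (i < j)%N} &
          m 0%N = 0%N] /\
      (* (i) *) (sup_L2normsq F < +oo)%E /\
      (* (ii) *) (forall j k, (j < k)%N ->
        complex.Re `|inner_product (F (m k)) (F (m j))| <= eta k) /\
      (* (iii) *) (forall k1 k2, k1 <> k2 -> Psi_ k1 `&` Psi_ k2 = set0) /\
      (* (iv) *) (forall k,
        (\esum_(psi in Psi `\` Psi_ k) L2normsq (convolution (F (m k)) psi)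
          <= (eta k)%:E)%E) /\
      (* (v) *) (forall j k, (j < k)%N ->
        (\esum_(psi in Psi_ k) L2normsq (convolution (F (m j)) psi)
          <= (eta k)%:E)%E) /\
      (* (vi) *) (forall k, (0 < k)%N ->
        ((4 * delta)%:E <= energy_remainder Psi k (F (m k)))%E))
  (E : nat -> R)
  (E_gt0 : forall N, (0 < N)%N -> 0 < E N)
  (E_nonincr : forall M N, (0 < M)%N -> (M <= N)%N -> E N <= E M)
  (E_null : E @ \oo --> (0 : R)) :
  exists fE : cfun R d,
    [/\ cLfun 2%:E fE,
        (L2normsq fE <= 2%:E * sup_L2normsq F * (1 + E 1%N)%:E)%E,
        (L2normsq (fE \- F 0%N)%R <= 2%:E * sup_L2normsq F * (E 1%N)%:E)%E &
        forall N, (0 < N)%N -> ((delta * E N)%:E <= energy_remainder Psi N fE)%E].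
Proof.
have Psi_L2 : Psi `<=` cLfun 2%:E by move=> psi /Psi_L1L2[].
have bessel f : cLfun 2%:E f ->
    (\esum_(psi in Psi) L2normsq (convolution f psi) <= L2normsq f)%E.
  by move=> Lf; rewrite -(filters_Parseval _ Lf) leeDr// L2normsq_ge0.
have E1_gt0 : 0 < E 1%N by exact: E_gt0.
have [k [k_homo k_gt kE]] := exists_scales E1_gt0 E_null.
pose r := Num.sqrt (3 / 4 * E 1%N).
have r2E : r ^+ 2 = 3 / 4 * E 1%N by rewrite sqr_sqrtr// mulr_ge0// ltW.
have r_gt0 : 0 < r by rewrite sqrtr_gt0 mulr_gt0.
(* chosen so that eps (4 + 41 r^2) <= (4/3) delta r^2, the loss allowed below *)
pose eps := delta * r ^+ 2 / (3 + 31 * r ^+ 2).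
have den_gt0 : 0 < 3 + 31 * r ^+ 2 by rewrite ltr_pwDl// mulr_ge0// sqr_ge0.
have eps_gt0 : 0 < eps by rewrite divr_gt0// mulr_gt0// exprn_gt0.
have epsE : eps * (3 + 31 * r ^+ 2) = delta * r ^+ 2.
  by rewrite /eps divfK// gt_eqF.
pose eta n := eps * 64^-1 ^+ n.
have eta_gt0 n : 0 < eta n by rewrite mulr_gt0// exprn_gt0.
have eta_le i j : (i <= j)%N -> eta j <= eta i.
  move=> ij; rewrite ler_wpM2l//; first exact: ltW.
  by rewrite ler_wiXn2l//; lra.
have [Psi_ [m [[Psi_fin Psi_sub m_homo m0] [sup_fin [_ [Psi_disj
  [Psi_out [Psi_in Wm]]]]]]]] := hyp eta eta_gt0.
have sup_ge n : (L2normsq (F n) <= sup_L2normsq F)%E.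
  by apply: ereal_sup_ubound; exists n.
pose C := fine (sup_L2normsq F).
have CE : sup_L2normsq F = C%:E.
  by rewrite fineK// ge0_fin_numE// (le_trans _ (sup_ge 0%N))// L2normsq_ge0.
have C_ge0 : 0 <= C by rewrite -lee_fin -CE (le_trans _ (sup_ge 0%N))// L2normsq_ge0.
pose c j := r * 8^-1 ^+ j.
(* the tail r (8^-j + 8^-(j+1) + ...) of the weights *)
pose T j := 8 / 7 * c j.
pose g j := F (m (k j)).
have c_gt0 j : 0 < c j by rewrite mulr_gt0// exprn_gt0.
have Lg j : cLfun 2%:E (g j) by exact: F_L2.
have [|||n|h Lh h_dist] := @L2_series R d c g Lg T C.
- by move=> j; exact: ltW.
- by move=> j; rewrite mulr_gt0.
- by move=> j; rewrite /T /c exprS; field.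
- by rewrite -CE; exact: sup_ge.
have h_le : (L2normsq h <= (E 1%N * C)%:E)%E.
  have -> : L2normsq h = L2normsq (h \- partial_sum c g 0).
    rewrite !L2normsqE; apply: eq_integral => x _.
    by rewrite /= partial_sum0 subr0.
  apply: le_trans (h_dist 0%N) _; rewrite lee_fin mulrA ler_wpM2r//.
  rewrite /T /c expr0 mulr1.
  have -> : 8 / 7 * r * (8 / 7 * r) = 64 / 49 * r ^+ 2 by field.
  rewrite r2E; lra.
exists (F 0%N \+ h); split.
- exact: cLfun2D.
- rewrite CE; apply: le_trans (L2normsqD _ _) _; [by case: (F_L2 0)|by case: Lh|].
  apply: (@le_trans _ _ (2%:E * C%:E + 2%:E * (E 1%N * C)%:E)%E).
    by apply: leeD; apply: lee_wpmul2l => //; rewrite -CE.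
  by rewrite -!EFinM -EFinD lee_fin; lra.
- have -> : (F 0%N \+ h) \- F 0%N = h.
    by apply/funext => x /=; rewrite addrC addKr.
  rewrite CE; apply: le_trans h_le _; rewrite -!EFinM lee_fin.
  have := mulr_ge0 C_ge0 (ltW E1_gt0); lra.
case=> // N _.
have [l Nl El] := exists_scale (ltn0Sn N) E_nonincr k_gt kE.
have k_le i j : (i <= j)%N -> (k i <= k j)%N.
  by rewrite leq_eqVlt => /predU1P[->//|/k_homo/ltnW].
have eta_kl j : eta (k j) <= eta j by apply: eta_le; exact: ltnW.
have low := @energy_remainder_superposition R d Psi Psi_L2 bessel
  (Psi_ (k l)) (F 0%N) h g c r (eta l) (4 * delta) l N (Psi_sub _) (F_L2 0)
  Lh Lg r_gt0 (eta_gt0 l) (fun j => erefl).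
(* Phi = Psi_(k_l), with B = eta l bounding eta (k_j) for all j >= l *)
have {}low : (((4 * delta - eta l) * c l ^+ 2 - (4 + 40 * r ^+ 2) * eta l)%:E <=
    2%:E * energy_remainder Psi N.+1 (F 0%N \+ h)%R)%E.
  apply: low.
  - move=> e e_gt0.
    have T_cvg : T n * (T 0%N * C) @[n --> \oo] --> (0 : R).
      rewrite -(mulr0 (8 / 7 * r * (T 0%N * C))).
      rewrite (_ : (fun n => _) =
          fun n => 8 / 7 * r * (T 0%N * C) * 8^-1 ^+ n); last first.
        by apply/funext => n; rewrite /T /c; ring.
      apply: cvgMr; apply: cvg_expr.
      by rewrite ger0_norm; lra.
    have /cvgrPdist_le /(_ _ e_gt0)[M _ HM] := T_cvg.
    exists (maxn M l.+1); first exact: leq_maxr.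
    apply: le_trans (h_dist _) _; rewrite lee_fin.
    have := HM (maxn M l.+1) (leq_maxl _ _); rewrite sub0r normrN.
    exact/le_trans/ler_norm.
  - have := @Psi_in 0%N (k l); rewrite m0 => h0.
    by apply: le_trans (h0 (leq_ltn_trans (leq0n _) (k_gt l))) _; rewrite lee_fin.
  - move=> j; rewrite neq_ltn => /orP[jl|lj].
      by apply: le_trans (Psi_in _ _ (k_homo _ _ jl)) _; rewrite lee_fin.
    apply: (@le_trans _ _ (\esum_(psi in Psi `\` Psi_ (k j))
        L2normsq (convolution (g j) psi))%E).
      apply: le_esum_subset => psi psil; split; first exact: Psi_sub psil.
      move=> psij; have : (Psi_ (k l) `&` Psi_ (k j)) psi by [].
      by rewrite Psi_disj// => klj; have := k_homo _ _ lj; rewrite klj ltnn.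
    apply: le_trans (Psi_out _) _; rewrite lee_fin.
    by apply: le_trans (eta_kl j) _; apply: eta_le; exact: ltnW.
  - by apply: le_trans (Psi_out _) _; rewrite lee_fin.
  - apply: le_trans (Wm (k l) (leq_ltn_trans (leq0n _) (k_gt l))) _.
    exact: (energy_remainder_antitone Psi_L2 bessel).
suff : ((2 * (delta * E N.+1))%:E <=
    2%:E * energy_remainder Psi N.+1 (F 0%N \+ h)%R)%E.
  by rewrite EFinM lee_pmul2l.
apply: le_trans low; rewrite lee_fin.
set q : R := 64^-1 ^+ l in El *.
have q_gt0 : 0 < q by rewrite exprn_gt0.
have q_le1 : q <= 1 by rewrite exprn_ile1//; lra.
(* with X = delta q E_1: the main term is 3 X, the errors add up to at most X,
   and E_N <= q E_1 *)
have -> : c l ^+ 2 = r ^+ 2 * q.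
  by rewrite /c exprMn exprAC /q; congr (_ * _ ^+ _); field.
rewrite -/(eta l) (_ : eta l = eps * q)//.
have rq : r ^+ 2 * q = 3 / 4 * (q * E 1%N) by rewrite r2E; ring.
have dE : delta * E N.+1 <= delta * (q * E 1%N) by rewrite ler_wpM2l// ltW.
have eq1 : eps * q * (r ^+ 2 * q) <= eps * q * r ^+ 2.
  apply: ler_wpM2l; first by apply: mulr_ge0; exact: ltW.
  by rewrite ger_pMr// exprn_gt0.
have eq2 : eps * q * (4 + 41 * r ^+ 2) <= 4 / 3 * (delta * r ^+ 2) * q.
  rewrite -epsE mulrAC ler_wpM2r ?(ltW q_gt0)// -subr_ge0.
  rewrite (_ : _ - _ = eps * r ^+ 2 / 3); last by field.
  by rewrite divr_ge0// mulr_ge0 ?sqr_ge0// ltW.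
rewrite mulrBl.
have : 4 * delta * (r ^+ 2 * q) = 3 * (delta * (q * E 1%N)) by rewrite rq; field.
have : 4 / 3 * (delta * r ^+ 2) * q = delta * (q * E 1%N).
  by rewrite -[LHS]mulrA -(mulrA delta) rq; field.
move: eq1 eq2 dE.
lra.
Qed.
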